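(* Let $\{a_n\}_{n\in\mathbb{N}}$ be a sequence in the quaternions $\mathbb{H}$, let $R\in(0,+\infty]$, and suppose that the regular power series $\sum_{n\in\mathbb{N}} q^n a_n$ converges in $B=B(0,R)=\{q\in\mathbb{H}:|q|<R\}$, with sum $f:B\to\mathbb{H}$. Then $f$ is quaternionic analytic at every point of the open set $$\mathcal{A}(B)=\{p\in\mathbb{H} : 2|Im(p)|<R-|p|\}.$$
   Context: $\mathbb{H}$ is the skew field of real quaternions $q=x_0+x_1i+x_2j+x_3k$, with $Re(q)=x_0$, $Im(q)=x_1i+x_2j+x_3k$ and Euclidean modulus $|q|$. Quaternionic polynomials and power series in $q$ are written with coefficients on the right, $\sum_n q^n a_n$. The regular multiplication $*$ is defined by $\left(\sum_n q^n a_n\right)*\left(\sum_n q^n b_n\right)=\sum_n q^n\sum_{k=0}^n a_kb_{n-k}$. For $p\in\mathbb{H}$, $(q-p)^{*n}=(q-p)*\cdots*(q-p)$ ($n$ factors; equal to $1$ for $n=0$) is the $n$-th power of the polynomial $q-p$ with respect to $*$, evaluated at $q$. A regular power series centered at $p$ is a series $\sum_{n\in\mathbb{N}}(q-p)^{*n}b_n$ with $b_n\in\mathbb{H}$; convergence is with respect to the Euclidean norm. Let $\Omega\subseteq\mathbb{H}$ be (Euclidean) open. A function $f:\Omega\to\mathbb{H}$ is quaternionic analytic at $p\in\Omega$ if there exist a (Euclidean) neighborhood $U$ of $p$ in $\Omega$ and a regular power series $\sum_n (q-p)^{*n}b_n$ converging in $U$ such that $f(q)=\sum_n(q-p)^{*n}b_n$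 for all $q\in U$. If $R=+\infty$ then $B=\mathbb{H}$ and $\mathcal{A}(B)=\mathbb{H}$. *)

(* Defs.v *)
From HB Require Import structures.
From mathcomp Require Import all_boot all_order all_algebra.
From mathcomp Require Import ring lra.
From mathcomp Require Import all_classical all_reals all_analysis.
Set Implicit Arguments.
Unset Strict Implicit.
Unset Printing Implicit Defensive.
Import Order.TTheory GRing.Theory Num.Theory.
Import numFieldNormedType.Exports.
Local Open Scope classical_set_scope.
Local Open Scope ring_scope.

Record quat (R : Type) : Type :=
  Quat { qre : R; qi : R; qj : R; qk : R }.

Section QuatEncoding.
Variable R : Type.

Definition quat_tuple (q : quat R) : R * R * R * R :=
  (qre q, qi q, qj q, qk q).

Definition tuple_quat (t : R * R * R * R) : quat R :=
  Quat t.1.1.1 t.1.1.2 t.1.2 t.2.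

Lemma quat_tupleK : cancel quat_tuple tuple_quat.
Proof. by case. Qed.

Lemma quatP (p q : quat R) :
  qre p = qre q -> qi p = qi q -> qj p = qj q -> qk p = qk q -> p = q.
Proof. by case: p q => ? ? ? ? [? ? ? ?] /= -> -> -> ->. Qed.

End QuatEncoding.

HB.instance Definition _ (R : choiceType) :=
  Choice.copy (quat R) (can_type (@quat_tupleK R)).

Section QuatRing.
Variable R : realType.
Implicit Types p q r : quat R.

Definition addq p q :=
  Quat (qre p + qre q) (qi p + qi q) (qj p + qj q) (qk p + qk q).

Definition oppq p := Quat (- qre p) (- qi p) (- qj p) (- qk p).

Definition zeroq : quat R := Quat 0 0 0 0.

Lemma addqA : associative addq.
Proof. by move=> p q r; apply: quatP; rewrite /= addrA. Qed.

Lemma addqC : commutative addq.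
Proof. by move=> p q; apply: quatP; rewrite /= addrC. Qed.

Lemma add0q : left_id zeroq addq.
Proof. by move=> p; apply: quatP; rewrite /= add0r. Qed.

Lemma addNq : left_inverse zeroq oppq addq.
Proof. by move=> p; apply: quatP; rewrite /= addNr. Qed.

HB.instance Definition _ :=
  GRing.isZmodule.Build (quat R) addqA addqC add0q addNq.

Definition oneq : quat R := Quat 1 0 0 0.

Definition mulq p q := Quat
  (qre p * qre q - qi p * qi q - qj p * qj q - qk p * qk q)
  (qre p * qi q + qi p * qre q + qj p * qk q - qk p * qj q)
  (qre p * qj q - qi p * qk q + qj p * qre q + qk p * qi q)
  (qre p * qk q + qi p * qj q - qj p * qi q + qk p * qre q).

Lemma mulqA : associative mulq.
Proof. by move=> p q r; apply: quatP => /=; ring. Qed.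

Lemma mul1q : left_id oneq mulq.
Proof. by move=> p; apply: quatP => /=; ring. Qed.

Lemma mulq1 : right_id oneq mulq.
Proof. by move=> p; apply: quatP => /=; ring. Qed.

Lemma mulqDl : left_distributive mulq addq.
Proof. by move=> p q r; apply: quatP => /=; ring. Qed.

Lemma mulqDr : right_distributive mulq addq.
Proof. by move=> p q r; apply: quatP => /=; ring. Qed.

Lemma oneq_neq0 : oneq != 0 :> quat R.
Proof. by apply/eqP => /(congr1 (@qre R)) /= /eqP; rewrite oner_eq0. Qed.

HB.instance Definition _ := GRing.Zmodule_isNzRing.Build (quat R)
  mulqA mul1q mulq1 mulqDl mulqDr oneq_neq0.

Definition scaleq (c : R) p := Quat (c * qre p) (c * qi p) (c * qj p) (c * qk p).

Lemma scaleqA c d p : scaleq c (scaleq d p) = scaleq (c * d) p.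
Proof. by apply: quatP; rewrite /= mulrA. Qed.

Lemma scale1q : left_id 1 scaleq.
Proof. by move=> p; apply: quatP; rewrite /= mul1r. Qed.

Lemma scaleqDr : right_distributive scaleq +%R.
Proof. by move=> c p q; apply: quatP; rewrite /= mulrDr. Qed.

Lemma scaleqDl p : {morph scaleq^~ p : c d / c + d}.
Proof. by move=> c d; apply: quatP; rewrite /= mulrDl. Qed.

HB.instance Definition _ := GRing.Zmodule_isLmodule.Build R (quat R)
  scaleqA scale1q scaleqDr scaleqDl.

Lemma scaleqAl (c : R) p q : c *: (p * q) = (c *: p) * q.
Proof. by apply: quatP => /=; ring. Qed.

HB.instance Definition _ := GRing.Lmodule_isLalgebra.Build R (quat R) scaleqAl.

Lemma scaleqAr (c : R) p q : c *: (p * q) = p * (c *: q).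
Proof. by apply: quatP => /=; ring. Qed.

HB.instance Definition _ := GRing.Lalgebra_isAlgebra.Build R (quat R) scaleqAr.

Definition normq2 p : R := qre p ^+ 2 + qi p ^+ 2 + qj p ^+ 2 + qk p ^+ 2.

Definition normq p : R := Num.sqrt (normq2 p).

Lemma normq2_ge0 p : 0 <= normq2 p.
Proof. by rewrite /normq2 !addr_ge0 ?sqr_ge0. Qed.

Lemma sqr_normq p : normq p ^+ 2 = normq2 p.
Proof. by rewrite sqr_sqrtr ?normq2_ge0. Qed.

Lemma normq2M p q : normq2 (p * q) = normq2 p * normq2 q.
Proof. by rewrite /normq2 /=; ring. Qed.

Lemma normqM p q : normq (p * q) = normq p * normq q.
Proof. by rewrite /normq normq2M sqrtrM ?normq2_ge0. Qed.

Lemma ler_normqD p q : normq (p + q) <= normq p + normq q.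
Proof.
have np : 0 <= normq p := sqrtr_ge0 _.
have nq : 0 <= normq q := sqrtr_ge0 _.
rewrite -(@ler_pXn2r _ 2) ?nnegrE ?addr_ge0 ?sqrtr_ge0 //.
rewrite sqrrD !sqr_normq.
set d := qre p * qre q + qi p * qi q + qj p * qj q + qk p * qk q.
have -> : normq2 (p + q) = normq2 p + d *+ 2 + normq2 q.
  by rewrite /normq2 /d /=; ring.
rewrite lerD2r lerD2l lerMn2r /=.
apply: le_trans (ler_norm d) _.
rewrite -(@ler_pXn2r _ 2) ?nnegrE ?mulr_ge0 // real_normK ?num_real //.
rewrite exprMn !sqr_normq -subr_ge0.
(* Lagrange's four-square identity *)
have -> : normq2 p * normq2 q - d ^+ 2 =
    (qre p * qi q - qi p * qre q) ^+ 2 + (qre p * qj q - qj p * qre q) ^+ 2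
    + (qre p * qk q - qk p * qre q) ^+ 2 + (qi p * qj q - qj p * qi q) ^+ 2
    + (qi p * qk q - qk p * qi q) ^+ 2 + (qj p * qk q - qk p * qj q) ^+ 2.
  by rewrite /normq2 /d; ring.
by rewrite !addr_ge0 ?sqr_ge0.
Qed.

Lemma normqZ (c : R) p : normq (c *: p) = `|c| * normq p.
Proof.
rewrite /normq -sqrtr_sqr -sqrtrM ?sqr_ge0 //; congr Num.sqrt.
by rewrite /normq2 /=; ring.
Qed.

Lemma normq_eq0 p : normq p = 0 -> p = 0.
Proof.
move=> /(congr1 (fun x => x ^+ 2)); rewrite sqr_normq expr0n /= /normq2.
move=> /eqP; rewrite !paddr_eq0 ?addr_ge0 ?sqr_ge0 // !sqrf_eq0.
by move=> /andP[/andP[/andP[/eqP ? /eqP ?] /eqP ?] /eqP ?]; apply: quatP.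
Qed.

HB.instance Definition _ := Lmodule_isNormed.Build R (quat R)
  ler_normqD normqZ normq_eq0.

Lemma quat_normE q : `|q| = Num.sqrt (normq2 q).
Proof. by []. Qed.

Definition qim q : quat R := Quat 0 (qi q) (qj q) (qk q).

End QuatRing.

Section RegularSeries.
Variable R : realType.

(* The product of {poly quat R} treats the variable as central, so it is the
   regular multiplication.  Evaluation puts the coefficients on the right;
   the library's P.[q] would put them on the left. *)
Definition reval (P : {poly quat R}) (q : quat R) : quat R :=
  \sum_(i < size P) q ^+ i * P`_i.

Definition regular_power (p : quat R) (n : nat) : quat R -> quat R :=
  reval (('X - p%:P) ^+ n).

Definition regular_series_sum (p : quat R) (b : nat -> quat R)
    (q l : quat R) : Prop :=
  series (fun n => regular_power p n q * b n) @ \oo --> l.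

Definition quaternionic_analytic_at (Omega : set (quat R))
    (f : quat R -> quat R) (p : quat R) : Prop :=
  exists U : set (quat R), [/\ nbhs p U, U `<=` Omega &
    exists b : nat -> quat R, forall q, U q -> regular_series_sum p b q (f q)].

Definition qball (r : \bar R) : set (quat R) :=
  [set q | (`|q|%:E < r)%E].

Definition analytic_domain (r : \bar R) : set (quat R) :=
  [set p | ((2 * `|qim p|)%:E < r - `|p|%:E)%E].

End RegularSeries.

(* Main.v *)
Require Import Defs.
From HB Require Import structures.
From mathcomp Require Import all_boot all_order all_algebra.
From mathcomp Require Import ring lra.
From mathcomp Require Import all_classical all_reals all_analysis.
Import Order.TTheory GRing.Theory Num.Theory.
Import numFieldNormedType.Exports.
Local Open Scope classical_set_scope.
Local Open Scope ring_scope.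

(** Since [X - p] commutes with the constant [p] in the ring of polynomials with
    central variable, the binomial formula gives
    [q^n = sum_k (q - p)^{*k} C(n, k) p^(n - k)], so the coefficients of the
    expansion at [p] must be [b_k = sum_n C(n, k) p^(n - k) a_n].  Each
    [(q - p)^{*k}] is a product of [k] factors [q' - p] with [q'] conjugate to
    [q], hence is bounded by [M^k] with [M] as close to [2|Im p|] as desired
    when [q] is close to [p].  If [M + |p| < rho < R], the double series is then
    dominated by the geometric series of ratio [t = (M + |p|) / rho], and the
    error after [K] terms of the expansion at [p] is [O(t^K)]. *)

(** * Multiplicative norm, imaginary part and conjugation *)

Section QuatNorm.
Variable R : realType.
Implicit Types p q : quat R.

Lemma quat_normM p q : `|p * q| = `|p| * `|q|.
Proof. exact: normqM. Qed.

Lemma quat_norm1 : `|1 : quat R| = 1.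
Proof. by rewrite quat_normE /normq2 /= !expr0n /= !addr0 expr1n sqrtr1. Qed.

Lemma quat_normX p n : `|p ^+ n| = `|p| ^+ n.
Proof.
by elim: n => [|n IHn]; rewrite ?expr0 ?quat_norm1 // !exprS quat_normM IHn.
Qed.

Lemma sqr_quat_norm q : `|q| ^+ 2 = normq2 q.
Proof. exact: sqr_normq. Qed.

Lemma sqr_norm_qim q : `|qim q| ^+ 2 = `|q| ^+ 2 - qre q ^+ 2.
Proof. by rewrite !sqr_quat_norm /normq2 /=; ring. Qed.

Lemma norm_qim_le q : `|qim q| <= `|q|.
Proof.
by rewrite -(@ler_pXn2r _ 2) ?nnegrE // sqr_norm_qim gerBl sqr_ge0.
Qed.

Lemma norm_qre_le q : `|qre q| <= `|q|.
Proof.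
rewrite -(@ler_pXn2r _ 2) ?nnegrE // real_normK ?num_real //.
by rewrite -subr_ge0 -sqr_norm_qim sqr_ge0.
Qed.

Lemma qimB p q : qim (p - q) = qim p - qim q.
Proof. by apply: quatP => //=; rewrite subr0. Qed.

Lemma norm_le_add_dist (V : normedModType R) (x y : V) :
  `|y| <= `|x| + `|x - y|.
Proof. by rewrite -lerBlDl distrC; exact: lerB_dist. Qed.

Lemma norm_qim_le_add_dist p q : `|qim q| <= `|qim p| + `|p - q|.
Proof.
apply: le_trans (norm_le_add_dist _ (qim p) (qim q)) _.
by rewrite lerD2l -qimB norm_qim_le.
Qed.

Lemma norm_qre_qim_le q : `|q| <= `|qre q| + `|qim q|.
Proof.
have {1}-> : q = (qre q) *: (1 : quat R) + qim q.
  by apply: quatP => /=; ring.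
by apply: le_trans (ler_normD _ _) _; rewrite normrZ quat_norm1 mulr1.
Qed.

(** Take for [q'] the inverse of [c] times [q * c]. The real part of a product is invariant under
    cyclic permutation and the norm is multiplicative, so the norm of the imaginary part is
    preserved too. *)
Lemma quat_conjugate c q : c != 0 ->
  exists2 q', q * c = c * q' & qre q' = qre q /\ `|qim q'| = `|qim q|.
Proof.
move=> c0.
pose c' : quat R := `|c| ^- 2 *: Quat (qre c) (- qi c) (- qj c) (- qk c).
have nc0 : normq2 c != 0 by rewrite -sqr_quat_norm expf_neq0 // normr_eq0.
have cc' : c * c' = 1.
  by apply: quatP; rewrite /= sqr_quat_norm /normq2 /= in nc0 *; field.
exists (c' * (q * c)); first by rewrite mulrA cc' mul1r.
have eRe : qre (c' * (q * c)) = qre q.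
  have -> : qre (c' * (q * c)) = qre (q * (c * c')) by rewrite /=; ring.
  by rewrite cc' mulr1.
split=> //.
apply: (@pexpIrn _ 2) => //; rewrite ?nnegrE //.
rewrite !sqr_norm_qim eRe; congr (_ ^+ 2 - _).
by rewrite !quat_normM mulrC -mulrA -quat_normM cc' quat_norm1 mulr1.
Qed.

Lemma cvg_quat_mull (x l : quat R) (u : nat -> quat R) :
  u @ \oo --> l -> (fun n => x * u n) @ \oo --> x * l.
Proof.
move=> ul; apply: cvg_zero; apply: norm_cvg0.
have -> : (fun n => `|((fun n => x * u n) - cst (x * l)) n|) =
          (fun n => `|x| * `|u n - l|).
  by apply/funext => n; rewrite /= -quat_normM mulrBr.
rewrite -(mulr0 `|x|); apply: cvgMl_tmp.
rewrite -(@normr0 _ (quat R)); apply: cvg_norm.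
by rewrite -(subrr l); apply: cvgB => //; exact: cvg_cst.
Qed.

End QuatNorm.

(** * Series dominated by a geometric series *)

Section GeometricDomination.
Variable R : realType.

(** Each real component is at most the norm in modulus, so the four component series converge by
    comparison; their limits are reassembled on the basis [1], [e1], [e2], [e3]. *)
Lemma geometric_dominated_cvg (u : nat -> quat R) (C t : R) :
  0 < t -> t < 1 -> (forall n, `|u n| <= C * t ^+ n) ->
  exists l : quat R, series u @ \oo --> l.
Proof.
move=> t0 t1 ut.
have geo : cvgn (series (geometric C t)).
  by apply: is_cvg_geometric_series; rewrite gtr0_norm.
have cvgc (v : nat -> R) : (forall n, `|v n| <= `|u n|) ->
    series v @ \oo --> limn (series v).
  move=> vu; apply: (@normed_cvg _ R^o).
  apply: series_le_cvg geo => n; rewrite /=.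
  - exact: normr_ge0.
  - exact: le_trans (normr_ge0 _) (ut n).
  - exact: le_trans (vu n) (ut n).
pose e1 : quat R := Quat 0 1 0 0.
pose e2 : quat R := Quat 0 0 1 0.
pose e3 : quat R := Quat 0 0 0 1.
pose l v := limn (series (fun n => v (u n : quat R) : R)).
exists (l (@qre R) *: (1 : quat R) + l (@qi R) *: e1 + l (@qj R) *: e2 +
  l (@qk R) *: e3).
have -> : series u = fun N =>
    series (fun n => qre (u n)) N *: (1 : quat R) +
    series (fun n => qi (u n)) N *: e1 +
    series (fun n => qj (u n)) N *: e2 + series (fun n => qk (u n)) N *: e3.
  apply/funext => N; rewrite /series /= !scaler_suml -!big_split /=.
  by apply: eq_bigr => n _; apply: quatP => /=; ring.
have comp_le (q : quat R) c : c ^+ 2 <= normq2 q -> `|c| <= `|q|.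
  by move=> cq; rewrite -(@ler_pXn2r _ 2) ?nnegrE // real_normK ?num_real //
    sqr_quat_norm.
by apply: cvgD; [apply: cvgD; [apply: cvgD|]|]; apply: cvgZr_tmp;
  apply: cvgc => n; apply: comp_le; rewrite /normq2; nra.
Qed.

(** The bound is uniform in [N], so it passes to the sum of the series. *)
Lemma geometric_tail_le (V : normedModType R) (u : nat -> V) (C t : R) K N :
  0 < t -> t < 1 -> 0 <= C -> (forall n, (n < K)%N -> u n = 0) ->
  (forall n, `|u n| <= C * t ^+ n) ->
  `|series u N| <= C / (1 - t) * t ^+ K.
Proof.
move=> t0 t1 C0 u0 ut.
have u0s m : (m <= K)%N -> \sum_(0 <= n < m) u n = 0.
  move=> mK; rewrite big_nat big1 // => n /andP[_ nm].
  by apply: u0; exact: leq_trans nm mK.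
have [NK|KN] := leqP N K.
  rewrite /series /= u0s // normr0 !mulr_ge0 ?invr_ge0 ?exprn_ge0 ?subr_ge0 //;
  exact: ltW.
rewrite /series /= (big_cat_nat (n := K)) ?(ltnW KN) //= u0s // add0r.
apply: le_trans (ler_norm_sum _ _ _) _.
apply: le_trans (ler_sum _ (fun n _ => ut n)) _.
rewrite -mulr_sumr -mulrA ler_wpM2l // mulrC.
rewrite -(subnK (ltnW KN)) addnC geometric_partial_tail.
apply: geometric_le_lim; rewrite ?gtr0_norm //.
by rewrite exprn_ge0 // ltW.
Qed.

End GeometricDomination.

(** * Evaluation of polynomials and regular powers *)

Section RegularPower.
Variable R : realType.
Implicit Types (p q : quat R) (P Q : {poly quat R}).

Lemma reval_widen P q n : (size P <= n)%N ->
  reval P q = \sum_(i < n) q ^+ i * P`_i.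
Proof.
move=> Pn; rewrite /reval (big_ord_widen n (fun i => q ^+ i * P`_i)) //.
rewrite big_mkcond; apply: eq_bigr => i _; case: ltnP => // Pi.
by rewrite nth_default // mulr0.
Qed.

Lemma reval_sum (I : Type) (r : seq I) (F : I -> {poly quat R}) q :
  reval (\sum_(i <- r) F i) q = \sum_(i <- r) reval (F i) q.
Proof.
elim/big_rec2: _ => [|i x P _ <-]; first by rewrite /reval size_poly0 big_ord0.
pose n := maxn (size (F i)) (size P).
rewrite (reval_widen (F i) q n) ?leq_maxl //.
rewrite (reval_widen P q n) ?leq_maxr //.
rewrite (reval_widen (F i + P) q n) ?size_polyD //.
by rewrite -big_split /=; apply: eq_bigr => j _; rewrite coefD mulrDr.
Qed.

Lemma reval_mul_polyC P c q : reval (P * c%:P) q = reval P q * c.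
Proof.
have sPc : (size (P * c%:P)%R <= size P)%N.
  by apply/leq_sizeP => j sj; rewrite coefMC nth_default // mul0r.
rewrite (reval_widen _ _ _ sPc) /reval mulr_suml.
by apply: eq_bigr => i _; rewrite coefMC mulrA.
Qed.

Lemma reval_Xn n q : reval 'X^n q = q ^+ n.
Proof.
rewrite /reval size_polyXn big_ord_recr /= coefXn eqxx mulr1 big1 ?add0r //.
by move=> i _; rewrite coefXn ltn_eqF // mulr0.
Qed.

(** Evaluation is not multiplicative: [p] joins the coefficients on the right of [q ^+ i], so
    [q - p] lands between that power and the coefficient of [P]. *)
Lemma reval_mul_XsubC p P q :
  reval (('X - p%:P) * P) q = \sum_(i < size P) q ^+ i * (q - p) * P`_i.
Proof.
have sP : (size (('X - p%:P) * P)%R <= (size P).+1)%N.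
  apply: leq_trans (size_polyMleq _ _) _.
  by rewrite size_XsubC.
rewrite (reval_widen _ _ _ sP) mulrBl -commr_polyX.
transitivity (\sum_(i < (size P).+1) (q ^+ i * (P * 'X)`_i) -
              \sum_(i < (size P).+1) q ^+ i * (p * P`_i)).
  by rewrite -sumrB; apply: eq_bigr => i _; rewrite coefB coefCM mulrBr.
rewrite big_ord_recl coefMX /= mulr0 add0r big_ord_recr /=.
rewrite (nth_default _ (leqnn (size P))) !mulr0 addr0 -sumrB.
apply: eq_bigr => i _.
by rewrite coefMX /= exprSr -!mulrA mulrBl mulrBr.
Qed.

(* [(X - p) * P] evaluates at [q] to [(q - p) P(q')], where [q'] is the
   conjugate of [q] by [q - p]; so all the factors of [(q - p)^{*n}] have the
   form [q'' - p] with [q''] conjugate to [q]. *)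
Lemma norm_regular_power_le p q n :
  `|regular_power p n q| <= (`|qre q - qre p| + `|qim q| + `|qim p|) ^+ n.
Proof.
elim: n q => [|n IHn] q.
  rewrite /regular_power !expr0 /reval size_poly1 big_ord1 expr0 mul1r.
  by rewrite coef1 /= quat_norm1.
rewrite /regular_power [in X in X <= _]exprS reval_mul_XsubC.
have B0 : 0 <= `|qre q - qre p| + `|qim q| + `|qim p| by rewrite !addr_ge0.
have [->|qp] := eqVneq (q - p) 0.
  by rewrite big1 ?normr0 ?exprn_ge0 // => i _; rewrite mulr0 mul0r.
have [q' qq' [re_q' im_q']] := quat_conjugate _ _ q qp.
have qXq' i : q ^+ i * (q - p) = (q - p) * q' ^+ i.
  elim: i => [|i IHi]; first by rewrite !expr0 mul1r mulr1.
  by rewrite exprS -mulrA IHi mulrA qq' -mulrA -exprS.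
under eq_bigr do rewrite qXq' -mulrA.
rewrite -mulr_sumr quat_normM exprS ler_pM //.
  apply: le_trans (norm_qre_qim_le _ _) _; rewrite qimB -addrA lerD2l.
  exact: ler_normB.
by have := IHn q'; rewrite re_q' im_q'.
Qed.

(** The binomial coefficients vanish for [k] above [n], so one truncation order [m] serves all
    smaller exponents. *)
Lemma expr_regular_power p q n m : (n < m)%N ->
  q ^+ n = \sum_(k < m) regular_power p k q * (p ^+ (n - k) *+ 'C(n, k)).
Proof.
have cpX : GRing.comm p%:P ('X - p%:P).
  by apply: commrB; first exact: commr_polyX.
have eX : 'X = p%:P + ('X - p%:P) by rewrite addrC subrK.
move=> nm; rewrite -reval_Xn eX (exprDn_comm _ cpX) reval_sum.
rewrite [RHS](bigID (fun k : 'I_m => (k < n.+1)%N)) /=.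
rewrite [X in _ = _ + X]big1; last first.
  by move=> k; rewrite -leqNgt => nk; rewrite bin_small // mulr0n mulr0.
rewrite addr0 -(big_ord_widen m (fun k => regular_power p k q *
  (p ^+ (n - k) *+ 'C(n, k)))) //.
apply: eq_bigr => k _.
have -> := commrX k (commr_sym (commrX (n - k) (commr_sym cpX))).
by rewrite -polyC_exp -mulrnAr -polyCMn reval_mul_polyC.
Qed.

End RegularPower.

(** * The domain of analyticity *)

Section Domain.
Variable R : realType.

(** An intermediate real radius [rho] lets finite and infinite [r] be treated alike. *)
Lemma analytic_domainP (r : \bar R) (p : quat R) : (0 < r)%E ->
  analytic_domain r p <->
  exists2 rho : R, 2 * `|qim p| + `|p| < rho & (rho%:E < r)%E.
Proof.
rewrite /analytic_domain /=; case: r => [r||] // r0.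
- rewrite -EFinB lte_fin ltrBrDr; split.
    move=> h; exists ((2 * `|qim p| + `|p| + r) / 2); rewrite ?lte_fin; lra.
  by move=> [rho h1]; rewrite lte_fin; exact: lt_trans.
- rewrite addye ?eqNyN// ltry; split=> // _.
  by exists (2 * `|qim p| + `|p| + 1); rewrite ?ltry // ltrDl.
Qed.

Lemma open_analytic_domain (r : \bar R) : (0 < r)%E ->
  open (analytic_domain r).
Proof.
move=> r0; rewrite openE => p /(analytic_domainP _ _ r0) [rho prho rhor].
(* The divisor is 3 because twice the norm of the imaginary part plus the norm is 3-Lipschitz. *)
have e0 : 0 < (rho - (2 * `|qim p| + `|p|)) / 3 by rewrite divr_gt0 ?subr_gt0.
apply/nbhs_ballP; exists ((rho - (2 * `|qim p| + `|p|)) / 3) => //= q.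
rewrite -ball_normE /= => pq; apply/analytic_domainP => //.
exists rho => //.
have := norm_le_add_dist _ _ p q; have := norm_qim_le_add_dist _ p q; lra.
Qed.

End Domain.

(** * Rearrangement of the double series *)

Section Rearrangement.
Variables (R : realType) (a : nat -> quat R) (p : quat R) (C rho M : R).
Hypotheses (M0 : 0 < M) (Mrho : M + `|p| < rho).
Hypothesis aC : forall n, `|a n| * rho ^+ n <= C.

Let c n k : quat R := p ^+ (n - k) *+ 'C(n, k).
Let t := (M + `|p|) / rho.

Let C0 : 0 <= C.
Proof. by apply: le_trans (aC 0); rewrite mulr1. Qed.

Let rho0 : 0 < rho.
Proof. by apply: le_lt_trans Mrho; rewrite addr_ge0 // ltW. Qed.

Let t0 : 0 < t. Proof. by rewrite divr_gt0 // ltr_wpDr. Qed.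

Let t1 : t < 1. Proof. by rewrite ltr_pdivrMr // mul1r. Qed.

(** Any block of terms is dominated by the full binomial expansion of [M] plus the norm of [p], to
    the power [n]. Keeping [P] abstract covers both the coefficients and the regular powers. *)
Lemma taylor_terms_le n (P : nat -> quat R) m l :
  (forall k, `|P k| <= M ^+ k) ->
  `|\sum_(m <= k < l) P k * c n k * a n| <= C * t ^+ n.
Proof.
move=> PM.
have tn : (M + `|p|) ^+ n * `|a n| <= C * t ^+ n.
  rewrite /t exprMn exprVn mulrA ler_pdivlMr ?exprn_gt0 //.
  rewrite -mulrA mulrC ler_wpM2r // exprn_ge0 // addr_ge0 // ltW //.
apply: le_trans tn; apply: le_trans (ler_norm_sum _ _ _) _.
have cn k : `|c n k| = `|p| ^+ (n - k) *+ 'C(n, k).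
  by rewrite normrMn quat_normX.
apply: (@le_trans _ _ (\sum_(0 <= k < l) M ^+ k * `|c n k| * `|a n|)).
  have le_term k : `|P k * c n k * a n| <= M ^+ k * `|c n k| * `|a n|.
    by rewrite !quat_normM !ler_wpM2r.
  have ge0 k : 0 <= M ^+ k * `|c n k| * `|a n|.
    by rewrite !mulr_ge0 // exprn_ge0 // ltW.
  have [ml|lm] := leqP m l; last first.
    by rewrite big_geq ?(ltnW lm) // sumr_ge0.
  rewrite [leRHS](big_cat_nat (n := m)) //= ler_wpDl ?sumr_ge0 //.
  exact: ler_sum.
rewrite -mulr_suml ler_wpM2r //.
have -> : (M + `|p|) ^+ n = \sum_(0 <= k < n.+1) M ^+ k * `|c n k|.
  rewrite addrC exprDn big_mkord; apply: eq_bigr => k _.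
  by rewrite cn mulrnAr mulrC.
have tl j : (n < j)%N -> c n j = 0 by move=> nj; rewrite /c bin_small.
have [ln|nl] := leqP l n.+1.
  rewrite [leRHS](big_cat_nat (n := l)) //= lerDl sumr_ge0 // => k _.
  by rewrite mulr_ge0 // exprn_ge0 // ltW.
rewrite (big_cat_nat (n := n.+1)) ?(ltnW nl) //=.
rewrite [X in _ + X <= _]big_nat [X in _ + X <= _]big1.
  by rewrite addr0.
by move=> k /andP[nk _]; rewrite tl // normr0 mulr0.
Qed.

Lemma taylor_coef_cvg k :
  exists b : quat R, series (fun n => c n k * a n) @ \oo --> b.
Proof.
apply: (@geometric_dominated_cvg _ _ (M ^- k * C) t) => // n.
(* This choice of [P] isolates the single term of index [k]. *)
have PM j : `|if j == k then M ^+ k *: (1 : quat R) else 0| <= M ^+ j.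
  case: eqP => [->|_]; last by rewrite normr0 exprn_ge0 // ltW.
  by rewrite normrZ quat_norm1 mulr1 ger0_norm // exprn_ge0 // ltW.
have := taylor_terms_le n _ k k.+1 PM.
rewrite big_nat1 eqxx -mulrA -scalerAl mul1r normrZ.
rewrite ger0_norm ?exprn_ge0 ?(ltW M0) // -mulrA.
by rewrite [X in _ -> _ <= X]mulrC ler_pdivlMr ?exprn_gt0 // mulrC.
Qed.

Lemma regular_taylor (b : nat -> quat R) (q l : quat R) :
  (forall k, series (fun n => c n k * a n) @ \oo --> b k) ->
  `|qre q - qre p| + `|qim q| + `|qim p| <= M ->
  series (fun n => q ^+ n * a n) @ \oo --> l ->
  regular_series_sum p b q l.
Proof.
move=> cb qM ql; pose P k := regular_power p k q.
have PM k : `|P k| <= M ^+ k.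
  apply: le_trans (norm_regular_power_le _ _ _ _) _.
  by rewrite lerXn2r ?nnegrE ?addr_ge0 // ltW.
(* What remains of the term of index [n] after [K] terms of its expansion at [p]; it vanishes for
   [n < K], which yields the factor [t ^+ K]. *)
pose g K n := q ^+ n * a n - \sum_(0 <= k < K) P k * c n k * a n.
have g0 K n : (n < K)%N -> g K n = 0.
  move=> nK; rewrite /g big_mkord -mulr_suml.
  by rewrite -(expr_regular_power _ p q _ _ nK) subrr.
have gle K n : `|g K n| <= C * t ^+ n.
  have [nK|Kn] := ltnP n K.
    by rewrite g0 // normr0 mulr_ge0 // exprn_ge0 // ltW.
  rewrite /g (expr_regular_power _ p q _ _ (ltnSn n)) mulr_suml.
  rewrite -(big_mkord xpredT (fun k => P k * c n k * a n)).
  rewrite (big_cat_nat (n := K)) ?(leq_trans Kn) //= addrAC subrr add0r.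
  exact: taylor_terms_le.
(* For fixed [K] only finitely many series in [n] are combined, so no interchange of limits
   occurs. *)
have gcvg K : series (g K) @ \oo --> l - series (fun k => P k * b k) K.
  have -> : series (g K) = fun N => series (fun n => q ^+ n * a n) N -
      \sum_(0 <= k < K) P k * series (fun n => c n k * a n) N.
    apply/funext => N; rewrite /series /= sumrB exchange_big /=.
    congr (_ - _); apply: eq_bigr => k _; rewrite mulr_sumr.
    by apply: eq_bigr => n _; rewrite mulrA.
  apply: cvgB => //; rewrite /series /=.
  elim: K => [|K IHK].
    by under eq_fun do rewrite big_geq //; rewrite big_geq //; exact: cvg_cst.
  under eq_fun do rewrite big_nat_recr //=.
  rewrite big_nat_recr //=; apply: cvgD => //.
  apply: cvg_quat_mull; exact: cb.
have err K : `|l - series (fun k => P k * b k) K| <= C / (1 - t) * t ^+ K.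
  apply: (cvgr_to_le (cvg_norm (gcvg K))); apply: nearW => N.
  by apply: geometric_tail_le => //; exact: g0.
rewrite /regular_series_sum; apply: cvg_zero; apply: norm_cvg0.
apply: (@squeeze_cvgr _ _ _ _ (cst 0) (geometric (C / (1 - t)) t)).
- apply: nearW => K; rewrite normr_ge0 /=.
  by rewrite distrC; exact: err.
- exact: cvg_cst.
- by apply: cvg_geometric; rewrite gtr0_norm.
Qed.

End Rearrangement.

(** * Choice of the radii and conclusion *)

Theorem theorem1p7 (R : realType) (a : nat -> quat R) (r : \bar R)
    (f : quat R -> quat R) :
  (0 < r)%E ->
  (forall q, qball r q -> series (fun n => q ^+ n * a n) @ \oo --> f q) ->
  open (analytic_domain r) /\
  (forall p, analytic_domain r p -> quaternionic_analytic_at (qball r) f p).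
Proof.
move=> r0 af; split; first exact: open_analytic_domain.
move=> p /(analytic_domainP _ _ _ r0) [rho prho rhor].
(* On the ball of radius [e], the quantity to be bounded by [M] exceeds twice the norm of [qim p] by
   at most [2 * e]; the quarter leaves [M] plus the norm of [p] equal to [rho - 2 * e]. *)
pose e := (rho - (2 * `|qim p| + `|p|)) / 4.
have e0 : 0 < e by rewrite divr_gt0 ?subr_gt0.
pose M := 2 * `|qim p| + 2 * e.
have M0 : 0 < M by have := normr_ge0 (qim p); rewrite /M; lra.
have Mrho : M + `|p| < rho by rewrite /M /e in e0 *; lra.
have rho0 : 0 < rho by apply: le_lt_trans prho; rewrite addr_ge0 ?mulr_ge0.
have [C aC] : exists C, forall n, `|a n| * rho ^+ n <= C.
  (* Convergence at the real point [rho] makes the terms tend to zero, hence bounded. *)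
  pose q : quat R := rho *: 1.
  have qn : `|q| = rho by rewrite normrZ quat_norm1 mulr1 gtr0_norm.
  have /af /cvgP /cvg_series_cvg_0 /cvgP /cvg_seq_bounded : qball r q.
    by rewrite /qball /= qn.
  move=> [B [_ /(_ (B + 1))]]; rewrite ltrDl => /(_ ltr01) /= aC.
  exists (B + 1) => n; have := aC n I.
  by rewrite quat_normM quat_normX qn mulrC.
have [b bP] := choice (taylor_coef_cvg _ a p C rho M M0 Mrho aC).
have in_ball q : ball p e q -> qball r q.
  rewrite -ball_normE /= => pq; apply: lt_trans rhor; rewrite lte_fin.
  have := norm_le_add_dist _ _ p q; have := normr_ge0 (qim p).
  rewrite /e in e0 pq *; lra.
exists (ball p e); split => //; first exact: nbhsx_ballx.
exists b => q pq; apply: (regular_taylor _ a p C rho M) => //; last first.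
  by apply: af; exact: in_ball.
move: pq; rewrite -ball_normE /= => pq.
have hre : `|qre q - qre p| <= `|p - q|.
  by rewrite (distrC p); exact: (norm_qre_le _ (q - p)).
have := norm_qim_le_add_dist _ p q; rewrite /M; lra.
Qed.
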